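(* Let $x^0\in\mathcal S\cap\Omega$ and $\epsilon'>0$, and suppose that the sequence of iterates $(l^k,t^k,y^k,x^{k+1})$, $k=0,1,2,\dots$, is generated by the algorithm PS-DCA. Then for every $k=0,1,2,\dots$ one has $l^k\in\Omega$ and $x^{k+1}\in\mathcal S\cap\Omega$. If $y^k=t^k$, then $$E(x^k)\ge E(x^{k+1})+\frac{\rho_k\|t^k\|^2}{B(t^k)}+\frac{1}{\lambda_kB(l^k)}\|x^k-l^k\|^2.$$ Otherwise $y^k=l^k$, and $$E(x^k)\ge E(x^{k+1})+\frac{1}{\lambda_kB(l^k)}\|x^k-l^k\|^2.$$ Thus $E(x^k)=E(x^{k+1})$ if and only if $x^k=l^k=y^k=x^{k+1}$.
   Context: Standing assumptions: $T,B:\mathbb R^n\to\mathbb R$ are (finite-valued) convex functions with $T(\alpha x)=\alpha T(x)\ge 0$ and $B(\alpha x)=\alpha B(x)\ge 0$ for all $\alpha\ge 0$, $x\in\mathbb R^n$; moreover $\{x\in\mathbb R^n: B(x)=0\}\cap\{x\in\mathbb R^n: T(x)=0\}=\{0\}$ and $\Omega:=\{x\in\mathbb R^n: B(x)\ne 0\}$ is nonempty. For $x\in\Omega$, $E(x):=T(x)/B(x)$. $\|\cdot\|$ is the Euclidean norm, $\mathcal S:=\{x\in\mathbb R^n:\|x\|=1\}$, $\partial$ denotes the convex subdifferential, and $\mathrm{prox}_f(x):=\mathrm{argmin}_{y\in\mathbb R^n}\bigl(f(y)+\tfrac12\|x-y\|^2\bigr)$ for a proper lower semicontinuous convex $f$.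 Algorithm PS-DCA. Input: an initial point $x^0\in\mathcal S\cap\Omega$ and an acceptance parameter $\epsilon'>0$. For $k=0,1,2,\dots$: (i) take any $\lambda_k>0$ and any $v^k\in\partial B(x^k)$, and set $l^k=\mathrm{prox}_{\lambda_kT}(x^k+\lambda_kE(x^k)v^k)$; (ii) take any $\rho_k>0$ and any $w^k\in\partial B(0)$, and set $t^k=\mathrm{prox}_{T/\rho_k}\bigl(\tfrac{E(l^k)}{\rho_k}w^k\bigr)$; (iii) with $\tilde g^k(x)=T(x)+\tfrac{\rho_k}{2}\|x\|^2$ and $\tilde h^k(x)=E(l^k)B(x)+\tfrac{\rho_k}{2}\|x\|^2$, if $(\tilde g^k-\tilde h^k)(t^k)<-\epsilon'$ set $y^k=t^k$; otherwise set $y^k=l^k$; (iv) set $x^{k+1}=y^k/\|y^k\|$. *)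

(* Defs.v *)
From HB Require Import structures.
From mathcomp Require Import all_boot all_order all_algebra.
From mathcomp Require Import boolp classical_sets reals convex.

Set Implicit Arguments.
Unset Strict Implicit.
Unset Printing Implicit Defensive.

Import Order.TTheory GRing.Theory Num.Theory.
Local Open Scope classical_set_scope.
Local Open Scope ring_scope.

Section Definitions.
Variables (R : realType) (n : nat).
Implicit Types (f T B : 'rV[R]_n -> R) (x y v w : 'rV[R]_n).

Definition dotp x y : R := \sum_(i < n) x 0 i * y 0 i.

(* The library's norm `|x| on 'rV[R]_n is the sup norm, not the Euclidean one. *)
Definition enorm x : R := Num.sqrt (dotp x x).

Definition unit_sphere : set 'rV[R]_n := [set x | enorm x = 1].

Definition nonneg_homogeneous f :=
  forall (a : R) x, 0 <= a -> f (a *: x) = a * f x /\ 0 <= a * f x.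

Definition subdifferential f x : set 'rV[R]_n :=
  [set v | forall y, f x + dotp v (y - x) <= f y].

Definition argmin f : set 'rV[R]_n := [set y | forall z, f y <= f z].

(* [prox f x] is the set of minimizers; it is a singleton when f is convex, as
   for the real-valued (hence continuous) convex f used here, so membership in
   [prox f x] renders "equal to the proximal point". *)
Definition prox f x : set 'rV[R]_n :=
  argmin (fun y => f y + 2^-1 * enorm (x - y) ^+ 2).

Definition Omega B : set 'rV[R]_n := [set x | B x != 0].

(* Only meaningful on [Omega B]: the quotient is 0 where B vanishes. *)
Definition E T B x : R := T x / B x.

Definition gtilde T (rho : R) x : R := T x + rho / 2 * enorm x ^+ 2.

Definition htilde B (c rho : R) x : R := c * B x + rho / 2 * enorm x ^+ 2.

Record PS_DCA_step T B (eps' lambda rho : R) (x v l w t y x' : 'rV[R]_n) : Prop :=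
  {
    step_lambda_gt0 : 0 < lambda;
    step_v : subdifferential B x v;
    step_l : prox (fun z => lambda * T z) (x + (lambda * E T B x) *: v) l;
    step_rho_gt0 : 0 < rho;
    step_w : subdifferential B 0 w;
    step_t : prox (fun z => T z / rho) ((E T B l / rho) *: w) t;
    step_y : y = if gtilde T rho t - htilde B (E T B l) rho t < - eps'
                 then t else l;
    step_x' : x' = (enorm y)^-1 *: y
  }.

Definition PS_DCA T B (x0 : 'rV[R]_n) (eps' : R) (lambda rho : nat -> R)
    (x v l w t y : nat -> 'rV[R]_n) : Prop :=
  x 0%N = x0 /\
  forall k, PS_DCA_step T B eps' (lambda k) (rho k)
              (x k) (v k) (l k) (w k) (t k) (y k) (x k.+1).

End Definitions.

(* Main.v *)
(** Two consequences of the optimality of a proximal point drive the estimate.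
    At [l], comparing with [x] and using [<v, x> >= B x] and [<v, l> <= B l]
    gives [E x * B l >= T l + |x - l|^2 / lambda]; this also forces [B l != 0],
    since otherwise [x = l].  At [t], comparing with the origin gives
    [T t + rho |t|^2 <= E l * B t].  Dividing by [B l] and [B t], and using the
    invariance of [E] under positive scaling, yields the descent.  *)
Require Import Defs.
From HB Require Import structures.
From mathcomp Require Import all_boot all_order all_algebra.
From mathcomp Require Import boolp classical_sets reals interval_inference convex.
From mathcomp Require Import ring lra.

Set Implicit Arguments.
Unset Strict Implicit.
Unset Printing Implicit Defensive.

Import Order.TTheory GRing.Theory Num.Theory.
Local Open Scope classical_set_scope.
Local Open Scope ring_scope.

(** * Euclidean inner product and norm on row vectors *)

Section EuclideanSpace.
Variables (R : realType) (n : nat).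
Implicit Types (x y z : 'rV[R]_n) (a : R).

Lemma dotpC x y : dotp x y = dotp y x.
Proof. by apply: eq_bigr => i _; rewrite mulrC. Qed.

Lemma dotpDl x y z : dotp (x + y) z = dotp x z + dotp y z.
Proof. by rewrite -big_split; apply: eq_bigr => i _; rewrite mxE mulrDl. Qed.

Lemma dotpZl a x y : dotp (a *: x) y = a * dotp x y.
Proof. by rewrite mulr_sumr; apply: eq_bigr => i _; rewrite mxE mulrA. Qed.

Lemma dotpDr x y z : dotp z (x + y) = dotp z x + dotp z y.
Proof. by rewrite ![dotp z _]dotpC dotpDl. Qed.

Lemma dotpZr a x y : dotp x (a *: y) = a * dotp x y.
Proof. by rewrite dotpC dotpZl dotpC. Qed.

Lemma dotpNl x y : dotp (- x) y = - dotp x y.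
Proof. by rewrite -scaleN1r dotpZl mulN1r. Qed.

Lemma dotpNr x y : dotp x (- y) = - dotp x y.
Proof. by rewrite dotpC dotpNl dotpC. Qed.

Lemma dotp0r x : dotp x 0 = 0.
Proof. by rewrite -(scale0r 0) dotpZr mul0r. Qed.

(** Bilinear expansion: it leaves inner products of single vectors, which [lra] takes as atoms once
    symmetric pairs are oriented by [dotpC]. *)
Definition dotpE := (dotpDl, dotpDr, dotpNl, dotpNr, dotpZl, dotpZr, dotp0r).

Lemma enorm_sqr x : enorm x ^+ 2 = dotp x x.
Proof. by rewrite sqr_sqrtr// sumr_ge0// => i _; rewrite -expr2 sqr_ge0. Qed.

Lemma enorm_ge0 x : 0 <= enorm x.
Proof. exact: sqrtr_ge0. Qed.

Lemma enorm_eq0 x : (enorm x == 0) = (x == 0).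
Proof.
rewrite -sqrf_eq0 enorm_sqr; apply/idP/eqP => [|->]; last by rewrite dotp0r.
rewrite psumr_eq0 => [/allP x0|i _]; last by rewrite -expr2 sqr_ge0.
apply/rowP => i; rewrite mxE; apply/eqP.
by have := x0 i (mem_index_enum i); rewrite /= mulf_eq0 orbb.
Qed.

Lemma enorm_gt0 x : (0 < enorm x) = (x != 0).
Proof. by rewrite lt0r enorm_eq0 enorm_ge0 andbT. Qed.

Lemma enormZ a x : enorm (a *: x) = `|a| * enorm x.
Proof. by rewrite /enorm dotpZl dotpZr mulrA -expr2 sqrtrM ?sqr_ge0// sqrtr_sqr. Qed.

Lemma enorm_normalize x : x != 0 -> enorm ((enorm x)^-1 *: x) = 1.
Proof.
move=> x0; rewrite enormZ ger0_norm ?invr_ge0 ?enorm_ge0//.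
by rewrite mulVf// enorm_eq0.
Qed.

End EuclideanSpace.

(** * First-order optimality of proximal points *)

Section Convexity.
Variables (R : realType) (n : nat).
Implicit Types (f : 'rV[R]_n -> R) (p q x y z : 'rV[R]_n).

(** Trades bundled points of the unit interval for a plain real [s], as the arithmetic below
    requires. *)
Lemma convex_functionTP f :
  convex_function [set: 'rV[R]_n] f <->
  forall (s : R) x y, 0 <= s <= 1 ->
    f (s *: x + (1 - s) *: y) <= s * f x + (1 - s) * f y.
Proof.
split=> [f_convex s x y s01|f_convex s x y _ _].
  have := @f_convex (Itv01 (proj1 (andP s01)) (proj2 (andP s01))) x y.
  by rewrite !inE => /(_ Logic.I Logic.I).
apply: f_convex; apply/andP; split.
  exact: ge0.
exact: le1.
Qed.

Lemma convex_functionZ f (a : R) : 0 <= a ->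
  convex_function [set: 'rV[R]_n] f ->
  convex_function [set: 'rV[R]_n] (fun z => a * f z).
Proof.
move=> a_ge0 /convex_functionTP f_convex; apply/convex_functionTP => s x y s01.
apply: le_trans (ler_wpM2l a_ge0 (f_convex s x y s01)) _.
by rewrite le_eqVlt; apply/orP; left; apply/eqP; ring.
Qed.

(* The minimality of [q] tested on the segment towards [z], to first order. *)
Lemma prox_subdifferential f p q : convex_function [set: 'rV[R]_n] f ->
  prox f p q -> subdifferential f q (p - q).
Proof.
move=> /convex_functionTP f_convex q_min z; rewrite -subr_le0.
(* [d] is the defect in the subgradient inequality at [z], and [s * b] bounds it for each step [s]
   along the segment. *)
set d := (X in X <= 0); set b := 2^-1 * dotp (z - q) (z - q).
have b_ge0 : 0 <= b by rewrite mulr_ge0// -enorm_sqr sqr_ge0.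
have small s : 0 < s -> s <= 1 -> d <= s * b.
  move=> s_gt0 s_le1; have s01 : 0 <= s <= 1 by rewrite ltW.
  have := f_convex s z q s01; have /= := q_min (s *: z + (1 - s) *: q).
  rewrite !enorm_sqr => min conv.
  (* The squares of [p - q] cancel; what remains is first order in [s] except for the term in
     [b]. *)
  have {min conv} : s * d <= s * (s * b).
    have := le_trans min (lerD conv (lexx _)).
    rewrite /d /b !dotpE !(dotpC z) !(dotpC q p); lra.
  by rewrite ler_pM2l.
rewrite leNgt; apply/negP => d_gt0; have db_gt0 : 0 < d + b by lra.
(* This explicit step replaces the limit [s -> 0]: it yields [d * (d + b) <= d * b], that is
   [d ^+ 2 <= 0]. *)
have := small (d / (d + b)); rewrite divr_gt0// ler_pdivrMr// mul1r.
rewrite lerDl b_ge0 => /(_ isT isT).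
rewrite mulrAC ler_pdivlMr//; nra.
Qed.

End Convexity.

(** * Positively homogeneous functions and the quotient [E] *)

Section Homogeneous.
Variables (R : realType) (n : nat).
Implicit Types (f T B : 'rV[R]_n -> R) (x v : 'rV[R]_n).

Lemma homogeneousZ f (a : R) x :
  nonneg_homogeneous f -> 0 <= a -> f (a *: x) = a * f x.
Proof. by move=> f_hom a_ge0; have [] := f_hom a x a_ge0. Qed.

Lemma homogeneous_ge0 f x : nonneg_homogeneous f -> 0 <= f x.
Proof. by move=> f_hom; have [_] := f_hom 1 x ler01; rewrite mul1r. Qed.

Lemma homogeneous0 f : nonneg_homogeneous f -> f 0 = 0.
Proof. by move=> f_hom; rewrite -(scale0r 0) homogeneousZ// mul0r. Qed.

Lemma Omega_gt0 B x : nonneg_homogeneous B -> Omega B x -> 0 < B x.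
Proof. by move=> B_hom Bx; rewrite lt0r Bx homogeneous_ge0. Qed.

Lemma Omega_neq0 B x : nonneg_homogeneous B -> Omega B x -> x != 0.
Proof. by move=> B_hom; apply: contra_neq => ->; exact: homogeneous0. Qed.

(** Subgradients are the linear minorants that touch [f] at [x]: taking [z = x] in the second part
    turns the first into Euler's identity. *)
Lemma subdifferential_homogeneous f x v : nonneg_homogeneous f ->
  subdifferential f x v ->
  f x <= dotp v x /\ forall z, dotp v z <= f z.
Proof.
move=> f_hom v_sub; split.
  by have := v_sub 0; rewrite homogeneous0// !dotpE; lra.
(* Test at [2 x], at the origin and at [z]. *)
move=> z; have := v_sub (2 *: x); have := v_sub 0; have := v_sub z.
rewrite homogeneous0// homogeneousZ// !dotpE; lra.
Qed.

Lemma E_ge0 T B x : nonneg_homogeneous T -> nonneg_homogeneous B -> 0 <= E T B x.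
Proof. by move=> ? ?; rewrite divr_ge0// homogeneous_ge0. Qed.

(** The factor [a] cancels in the quotient; hence normalizing [y] does not change the objective. *)
Lemma EZ T B (a : R) x : nonneg_homogeneous T -> nonneg_homogeneous B ->
  0 < a -> E T B (a *: x) = E T B x.
Proof.
move=> T_hom B_hom a_gt0; rewrite /E !homogeneousZ ?(ltW a_gt0)//.
by rewrite invfM mulrACA divff ?gt_eqF// mul1r.
Qed.

End Homogeneous.

(** * Estimates for a single iteration *)

Section Step.
Variables (R : realType) (n : nat) (T B : 'rV[R]_n -> R).
Hypotheses (T_convex : convex_function [set: 'rV[R]_n] T)
  (T_hom : nonneg_homogeneous T) (B_hom : nonneg_homogeneous B).
Implicit Types (x v l w t y : 'rV[R]_n) (lambda rho c : R).

Lemma proximal_step lambda x v l : 0 < lambda -> Omega B x ->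
  subdifferential B x v ->
  prox (fun z => lambda * T z) (x + (lambda * E T B x) *: v) l ->
  T l + lambda^-1 * enorm (x - l) ^+ 2 <= E T B x * B l.
Proof.
move=> lambda_gt0 xO v_sub l_prox.
have [Bx vB] := subdifferential_homogeneous B_hom v_sub; have Bl := vB l.
have := prox_subdifferential (convex_functionZ (ltW lambda_gt0) T_convex) l_prox x.
(* With [T x] in this form, the optimality inequality and [B x <= dotp v x] combine so that [B x]
   drops out. *)
have -> : T x = E T B x * B x by rewrite divfK.
have E_ge0 := E_ge0 x T_hom B_hom; move=> opt; rewrite -(ler_pM2l lambda_gt0).
rewrite mulrDr mulVKf ?gt_eqF// enorm_sqr.
have lE_ge0 : 0 <= lambda * E T B x by rewrite mulr_ge0// ltW.
have := ler_wpM2l lE_ge0 Bx; have := ler_wpM2l lE_ge0 Bl; move: opt.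
rewrite !dotpE !(dotpC l); lra.
Qed.

Lemma proximal_step_Omega lambda x l : 0 < lambda -> Omega B x ->
  T l + lambda^-1 * enorm (x - l) ^+ 2 <= E T B x * B l -> Omega B l.
Proof.
move=> lambda_gt0 xO l_le; apply/negP => /eqP Bl; move: l_le; rewrite Bl mulr0.
have Tl := homogeneous_ge0 l T_hom; apply/negP; rewrite -ltNge ltr_wpDl//.
rewrite mulr_gt0 ?invr_gt0// exprn_gt0// enorm_gt0 subr_eq0.
(* [x = l] would give [B x = B l = 0]. *)
by apply: contra_neq xO => ->.
Qed.

(** Here [c] stands for [E T B l]; its sign allows [dotp w t <= B t] to be multiplied by it. *)
Lemma truncated_step rho c w t : 0 < rho -> 0 <= c ->
  subdifferential B 0 w -> prox (fun z => T z / rho) ((c / rho) *: w) t ->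
  T t + rho * enorm t ^+ 2 <= c * B t.
Proof.
move=> rho_gt0 c_ge0 w_sub t_prox.
have [_ /(_ t) wt] := subdifferential_homogeneous B_hom w_sub.
have T_rho : convex_function [set: 'rV[R]_n] (fun z => T z / rho).
  under eq_fun do rewrite mulrC.
  by apply: convex_functionZ => //; rewrite invr_ge0 ltW.
have := prox_subdifferential T_rho t_prox 0.
rewrite homogeneous0// mul0r sub0r !dotpE -enorm_sqr -(ler_pM2l rho_gt0).
(* Optimality tested at the origin, cleared of the denominator [rho]. *)
rewrite [X in X <= _](_ : _ = T t - (c * dotp w t - rho * enorm t ^+ 2)).
  by have := ler_wpM2l c_ge0 wt; lra.
by field; rewrite gt_eqF.
Qed.

(* The bound for [y = t] also covers a rejected [t] that coincides with [l]:
   it only needs [B t != 0]. *)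
Lemma PS_DCA_step_descent eps' lambda rho x v l w t y x' :
  0 < eps' -> Omega B x -> PS_DCA_step T B eps' lambda rho x v l w t y x' ->
  [/\ Omega B l /\ Omega B y, enorm x' = 1 /\ E T B x' = E T B y,
      E T B l + (lambda * B l)^-1 * enorm (x - l) ^+ 2 <= E T B x,
      y = t \/ y = l &
      y = t -> E T B t + rho * enorm t ^+ 2 / B t <= E T B l].
Proof.
move=> eps'_gt0 xO [lambda_gt0 v_sub l_prox rho_gt0 w_sub t_prox y_def x'_def].
have l_le := proximal_step lambda_gt0 xO v_sub l_prox.
have lO := proximal_step_Omega lambda_gt0 xO l_le.
have El_ge0 := E_ge0 l T_hom B_hom.
have t_le := truncated_step rho_gt0 El_ge0 w_sub t_prox.
have y_tl : y = t /\ Omega B t \/ y = l.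
  move: y_def; case: ifP => [acc ->|_ ->]; [left; split=> //|by right].
  (* If [B t = 0], the tested difference is [T t >= 0], so it cannot lie below [- eps'] and [t]
     would not be accepted. *)
  apply/negP => /eqP Bt; move: acc; rewrite /gtilde /htilde Bt.
  have := homogeneous_ge0 t T_hom; lra.
have yO : Omega B y by case: y_tl => [[-> ]|->].
have y_neq0 := Omega_neq0 B_hom yO.
split=> //.
- split; first by rewrite x'_def enorm_normalize.
  by rewrite x'_def EZ// invr_gt0 enorm_gt0.
- have Bl := Omega_gt0 B_hom lO.
  by rewrite invfM mulrAC -mulrDl ler_pdivrMr.
- by case: y_tl => [[-> _]|->]; [left|right].
- move=> yt; rewrite yt in yO; have Bt := Omega_gt0 B_hom yO.
  by rewrite -mulrDl ler_pdivrMr.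
Qed.

End Step.

Theorem lemma5p1 (R : realType) (n : nat) (T B : 'rV[R]_n -> R)
  (T_convex : convex_function [set: 'rV[R]_n] T)
  (B_convex : convex_function [set: 'rV[R]_n] B)
  (T_hom : nonneg_homogeneous T) (B_hom : nonneg_homogeneous B)
  (BT_zero : [set x | B x = 0] `&` [set x | T x = 0] = [set 0])
  (Omega_nonempty : Omega B !=set0)
  (x0 : 'rV[R]_n) (x0_in : (@unit_sphere R n `&` Omega B) x0)
  (eps' : R) (eps'_gt0 : 0 < eps')
  (lambda rho : nat -> R) (x v l w t y : nat -> 'rV[R]_n)
  (run : PS_DCA T B x0 eps' lambda rho x v l w t y) :
  forall k : nat,
    [/\ Omega B (l k) /\ (@unit_sphere R n `&` Omega B) (x k.+1),
        y k = t k ->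
          E T B (x k) >= E T B (x k.+1)
                         + rho k * enorm (t k) ^+ 2 / B (t k)
                         + (lambda k * B (l k))^-1 * enorm (x k - l k) ^+ 2,
        y k <> t k ->
          y k = l k /\
          E T B (x k) >= E T B (x k.+1)
                         + (lambda k * B (l k))^-1 * enorm (x k - l k) ^+ 2 &
        E T B (x k) = E T B (x k.+1) <->
          [/\ x k = l k, l k = y k & y k = x k.+1]].
Proof.
have [x_0 steps] := run.
have descent k xO := PS_DCA_step_descent T_convex T_hom B_hom eps'_gt0 xO (steps k).
have E_next k : Omega B (x k) -> Omega B (x k.+1).
  move=> xO; have [[_ yO] _ _ _ _] := descent k xO.
  rewrite (step_x' (steps k)) /Omega /= homogeneousZ ?invr_ge0 ?enorm_ge0//.
  by rewrite mulf_neq0// invr_eq0 enorm_eq0 (Omega_neq0 B_hom).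
(* The one-step estimates presuppose [Omega B (x k)], so membership is first propagated along the
   whole run. *)
have x_in k : enorm (x k) = 1 /\ Omega B (x k).
  elim: k => [|k [_ xO]]; first by rewrite x_0.
  by split; [have [_ []] := descent k xO|exact: E_next].
move=> k; have [x_unit xO] := x_in k; have [x1_unit x1O] := x_in k.+1.
have [[lO yO] [_ ->] l_le y_tl t_le] := descent k xO.
have gain_gt0 z : Omega B z -> 0 < rho k * enorm z ^+ 2 / B z.
  move=> zO; rewrite divr_gt0 ?(Omega_gt0 B_hom)// mulr_gt0 ?(step_rho_gt0 (steps k))//.
  by rewrite exprn_gt0// enorm_gt0 (Omega_neq0 B_hom).
have lB_gt0 : 0 < (lambda k * B (l k))^-1.
  by rewrite invr_gt0 mulr_gt0 ?(Omega_gt0 B_hom)// (step_lambda_gt0 (steps k)).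
split=> //.
- by move=> yt; have := t_le yt; rewrite yt; lra.
- by case: y_tl => [//|-> _]; split.
- split=> [E_eq|[xl ly yx]]; last by rewrite xl ly.
  have d_ge0 : 0 <= (lambda k * B (l k))^-1 * enorm (x k - l k) ^+ 2.
    by rewrite mulr_ge0 ?(ltW lB_gt0)// sqr_ge0.
  (* If [y k = t k], the strictly positive gain at [t k] would make the objective drop, against the
     assumed equality. *)
  have yl : y k = l k.
    case: y_tl => // yt; have := t_le yt; have := gain_gt0 (y k) yO.
    rewrite -yt => gain_y t_le_y; suff : E T B (x k) < E T B (x k) by rewrite ltxx.
    lra.
  have xl : x k = l k.
    apply/eqP; rewrite -subr_eq0 -enorm_eq0 -sqrf_eq0.
    (* Restoring the positive factor turns the goal into the vanishing of the whole descent term. *)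
    rewrite -(mulrI_eq0 _ (mulfI (lt0r_neq0 lB_gt0))) eq_le d_ge0 andbT.
    by rewrite yl {yl} in E_eq; lra.
  (* Now [y k] equals the unit vector [x k], so normalizing leaves it fixed. *)
  by split=> //; rewrite ?yl// (step_x' (steps k)) yl -xl x_unit invr1 scale1r.
Qed.
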